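(* Let $n$ be an odd positive integer such that $D=n^2+1$ is squarefree. Then $h(D)>1$ if and only if $n>1$.
   Context: For a squarefree integer $D>1$, $h(D)$ denotes the class number of the real quadratic field $\mathbb{Q}(\sqrt D)$. *)

(* Defs.v *)
From mathcomp Require Import all_boot all_order all_algebra all_field.
From mathcomp Require Import finmap all_classical.

Set Implicit Arguments.
Unset Strict Implicit.
Unset Printing Implicit Defensive.

Import Order.TTheory GRing.Theory Num.Theory.

Local Open Scope classical_set_scope.
Local Open Scope ring_scope.

Definition squarefree (m : nat) : Prop :=
  (0 < m)%N /\ forall d : nat, (d ^ 2 %| m)%N -> d = 1%N.

(* Q(sqrt D), as the set of elements of a subfield of algC. *)
Definition quadratic_field (D : nat) : set algC :=
  [set x | exists a b : rat, x = ratr a + ratr b * sqrtC D%:R].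

Definition ring_of_integers (K : set algC) : set algC :=
  [set x | K x /\ x \in Aint].

Definition fractional_ideal (K I : set algC) : Prop :=
  [/\ I `<=` K,
      I 0 /\ (forall x y : algC, I x -> I y -> I (x + y)),
      forall a x : algC, ring_of_integers K a -> I x -> I (a * x),
      exists2 x : algC, I x & x != 0
    & exists2 d : algC, ring_of_integers K d /\ d != 0
        & forall x : algC, I x -> ring_of_integers K (d * x)].

(* The coset of I modulo principal fractional ideals: multiplying I by the
   fractional ideal generated by x gives x I. *)
Definition ideal_class (K I : set algC) : set (set algC) :=
  [set J | exists2 x : algC, K x /\ x != 0 & J = [set x * y | y in I]].

Definition ideal_classes (K : set algC) : set (set (set algC)) :=
  [set ideal_class K I | I in fractional_ideal K].

(* The order of the class group. As fset_set A is empty when A is infinite, a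
   positive value entails that there are finitely many classes. *)
Definition class_number (D : nat) : nat :=
  #|` fset_set (ideal_classes (quadratic_field D))|%fset.

(* Main.v *)
Require Import Defs.
From mathcomp Require Import all_boot all_order all_algebra all_field.
From mathcomp Require Import finmap all_classical.
From mathcomp Require Import ring lra zify.

Set Implicit Arguments.
Unset Strict Implicit.
Unset Printing Implicit Defensive.

Import Order.TTheory GRing.Theory Num.Theory.

(* Write [D = n^2 + 1] and [O = Z[sqrt D]], the ring of integers as [D = 2 mod 4].
   By Dirichlet's approximation theorem every [alpha] in the field has a
   multiple [m alpha], [1 <= m <= n], at distance of norm less than 1 from [O].
   Hence every ideal class contains an ideal [J] with [n! \in J <= O]. There are
   finitely many of these, and only [J = O] when [n = 1]. For [n > 1], a generator
   of the ramified ideal [(2, sqrt D)] would give a solution of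
   [x^2 - D y^2 = 2] or [-2], which is excluded by descent along the unit
   [n + sqrt D]. *)

Local Open Scope ring_scope.

(** * Elements of the quadratic field, their norms and conjugates *)

Definition qelt (D : nat) (a b : rat) : algC := ratr a + ratr b * sqrtC D%:R.

Definition qnorm (D : nat) (a b : rat) : rat := a ^+ 2 - D%:R * b ^+ 2.

Lemma qeltD D a b c d : qelt D a b + qelt D c d = qelt D (a + c) (b + d).
Proof. by rewrite /qelt !rmorphD /=; ring. Qed.

Lemma qeltM D a b c d :
  qelt D a b * qelt D c d = qelt D (a * c + D%:R * b * d) (a * d + b * c).
Proof.
rewrite /qelt !rmorphD !rmorphM /= ratr_nat.
have := sqrtCK (D%:R : algC); set s := sqrtC _ => <-.
ring.
Qed.

Lemma qnormM D a b c d :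
  qnorm D (a * c + D%:R * b * d) (a * d + b * c) = qnorm D a b * qnorm D c d.
Proof. by rewrite /qnorm; ring. Qed.

Lemma qelt_conjM D a b : qelt D a b * qelt D a (- b) = ratr (qnorm D a b).
Proof.
rewrite qeltM /qelt /qnorm [a * - b + b * a](_ : _ = 0); last by ring.
by rewrite rmorph0 mul0r addr0; congr ratr; ring.
Qed.

(** The square of the denominator of [r] divides [numq r ^ 2 * D] and is coprime to [numq r ^ 2], so
    it divides [D]. *)
Lemma squarefree_sqrM_int D (r : rat) :
  squarefree D -> r ^+ 2 * D%:R \is a Num.int -> r \is a Num.int.
Proof.
move=> [_ sqfD] /intrP[k rk]; rewrite Qint_def.
have E : (numq r ^+ 2 * D%:Z = k * denq r ^+ 2)%R.
  apply: (@intr_inj rat); rewrite !expr2 !intrM -rk numqE.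
  by rewrite -pmulrn; ring.
have /sqfD q1 : (`|denq r| ^ 2 %| D)%N.
  have cop : coprime (`|denq r| ^ 2) (`|numq r| ^ 2).
    by rewrite coprime_pexpl // coprime_pexpr // coprime_sym coprime_num_den.
  rewrite -(Gauss_dvdr _ cop) -!abszX.
  by rewrite -[D]/(`|D%:Z|%N) -abszM E abszM dvdn_mull.
by rewrite -(gez0_abs (denq_ge0 r)) q1.
Qed.

Lemma squarefree_nonsquare D (r : rat) :
  squarefree D -> (1 < D)%N -> r ^+ 2 != D%:R.
Proof.
move=> sqfD D1; apply/eqP => rD.
have : r \is a Num.int.
  apply: (squarefree_sqrM_int sqfD); rewrite rD -natrM; exact: rpred_nat.
move=> /intrP[m rm].
have mD : (`|m| ^ 2)%N = D.
  suff : (m ^+ 2 = D%:Z)%R by rewrite -abszX => ->.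
  by apply: (@intr_inj rat); rewrite expr2 intrM -rm -expr2 rD -pmulrn.
have [_ /(_ `|m|%N)] := sqfD; rewrite mD dvdnn => /(_ isT) m1.
by move: D1; rewrite -mD m1.
Qed.

Section Nonsquare.

Variables (D : nat) (nsqD : forall r : rat, r ^+ 2 != D%:R).

Lemma qnorm_eq0 a b : qnorm D a b = 0 -> a = 0 /\ b = 0.
Proof.
rewrite /qnorm => N0; have [b0|b0] := eqVneq b 0.
  by move: N0; rewrite b0 expr0n mulr0 subr0 => /eqP; rewrite sqrf_eq0 => /eqP.
have /eqP[] := nsqD (a / b).
rewrite expr_div_n; apply/(canLR (mulfK _)); first by rewrite sqrf_eq0.
by apply/eqP; rewrite -subr_eq0 N0.
Qed.

Lemma qelt_eq0 a b : qelt D a b = 0 -> a = 0 /\ b = 0.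
Proof.
move=> z0; apply: qnorm_eq0; apply: (fmorph_inj (@ratr algC)).
by rewrite /= -qelt_conjM z0 mul0r rmorph0.
Qed.

Lemma qelt_inj a b c d : qelt D a b = qelt D c d -> a = c /\ b = d.
Proof.
move=> E; have /qelt_eq0[/eqP + /eqP] : qelt D (a - c) (b - d) = 0.
  have -> : qelt D (a - c) (b - d) = qelt D a b - qelt D c d.
    by rewrite /qelt !rmorphB /=; ring.
  by rewrite E subrr.
by rewrite !subr_eq0 => /eqP-> /eqP->.
Qed.

Lemma qeltV a b :
  (qelt D a b)^-1 = qelt D (a / qnorm D a b) (- b / qnorm D a b).
Proof.
(* Only [a = b = 0] has norm 0, and then both sides are 0 because [0^-1 = 0]. *)
have [N0|N0] := eqVneq (qnorm D a b) 0.
  have [-> ->] := qnorm_eq0 N0.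
  by rewrite /qelt oppr0 !mul0r rmorph0 mul0r addr0 invr0.
have z0 : qelt D a b != 0.
  apply: contraNneq N0 => z0; rewrite -(fmorph_eq0 (@ratr algC)).
  by rewrite /= -qelt_conjM z0 mul0r.
apply: (mulfI z0); rewrite divff // qeltM /qelt.
rewrite [X in ratr X + _](_ : _ = 1).
  rewrite [X in ratr X * _](_ : _ = 0); first by rewrite rmorph0 mul0r addr0 rmorph1.
  by field.
by move: N0; rewrite /qnorm => N0; field.
Qed.

(** Conjugation commutes with evaluation of integer polynomials: by induction on [p], its values at
    the two conjugates are conjugate. *)
Lemma qelt_conj_root (p : {poly int}) a b :
  root (map_poly intr p) (qelt D a b) -> root (map_poly intr p) (qelt D a (- b)).
Proof.
suff [u [v [pu pv]]] : exists u v : rat,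
    (map_poly intr p).[qelt D a b] = qelt D u v /\
    (map_poly intr p).[qelt D a (- b)] = qelt D u (- v).
  rewrite /root pu pv => /eqP /qelt_eq0[-> ->].
  by rewrite oppr0 /qelt rmorph0 mul0r addr0.
elim/poly_ind: p => [|p c [u [v [pu pv]]]].
  by exists 0, 0; rewrite rmorph0 !horner0 oppr0 /qelt rmorph0 mul0r addr0.
exists (u * a + D%:R * v * b + c%:~R), (u * b + v * a).
rewrite rmorphD rmorphM /= map_polyX map_polyC /= !hornerE pu pv !qeltM.
by rewrite /qelt !(rmorphD, rmorphN, rmorphM) /= ratr_int ratr_nat; split; ring.
Qed.

Lemma Aint_qelt_conj a b : qelt D a b \in Aint -> qelt D a (- b) \in Aint.
Proof.
move=> zA.
have /floorpP[p pE] : minCpoly (qelt D a b) \is a polyOver Num.int by [].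
have := root_minCpoly (qelt D a b); rewrite pE => /qelt_conj_root.
rewrite -pE => rt; apply: (root_monic_Aint rt (minCpoly_monic _)).
exact: zA.
Qed.

End Nonsquare.

(** * The ring of integers *)

Lemma ratr_Aint_int (r : rat) : (ratr r : algC) \in Aint -> r \is a Num.int.
Proof.
move=> /(Cint_rat_Aint (Crat_rat r)) /intrP[k rk].
suff -> : r = k%:~R by exact: rpred_int.
by apply: (fmorph_inj (@ratr algC)); rewrite /= rk ratr_int.
Qed.

(** The trace [A = 2 a] and the norm [N] are integers, so [(2 b)^2 D] is one too and [B = 2 b] is an
    integer. As [D = 2 mod 4], the equation [A^2 - D B^2 = 4 N] forces [A] and [B] to be even. *)
Lemma ring_of_integersE D (x : algC) :
  squarefree D -> (D %% 4 = 2)%N ->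
  ring_of_integers (quadratic_field D) x <->
  exists a b : int, x = qelt D a%:~R b%:~R.
Proof.
move=> sqfD D4; split; last first.
  move=> [a [b ->]]; split; first by exists a%:~R, b%:~R.
  rewrite /qelt !ratr_int rpredD ?Aint_int // rpredM ?Aint_int //.
  apply: (@root_monic_Aint ('X^2 - D%:R%:P)).
  - by rewrite rootE !hornerE sqrtCK subrr.
  - exact: monicXnsubC.
  - by rewrite polyOverXnsubC rpred_nat.
have D1 : (1 < D)%N by lia.
have nsqD r := squarefree_nonsquare r sqfD D1.
move=> [[a [b xE]] xA]; move: xA; rewrite {x}xE -/(qelt D a b) => zA.
have z'A := Aint_qelt_conj nsqD zA.
have /ratr_Aint_int/intrP[A aA] : (ratr (2 * a) : algC) \in Aint.
  have -> : ratr (2 * a) = qelt D a b + qelt D a (- b).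
    by rewrite qeltD /qelt subrr rmorph0 mul0r addr0; congr ratr; ring.
  exact: rpredD.
have /ratr_Aint_int/intrP[N nN] : (ratr (qnorm D a b) : algC) \in Aint.
  by rewrite -qelt_conjM; apply: rpredM.
have /(squarefree_sqrM_int sqfD)/intrP[B bB] :
    (2 * b) ^+ 2 * D%:R \is a Num.int.
  have -> : (2 * b) ^+ 2 * D%:R = (2 * a) ^+ 2 - 4 * qnorm D a b.
    by rewrite /qnorm; ring.
  by rewrite aA nN rpredB ?rpredM ?rpredX ?rpred_int ?rpred_nat.
have E : (A * A - D%:Z * B * B = 4 * N)%R.
  apply: (@intr_inj rat); rewrite intrD rmorphN /= !intrM -nN -aA -bB /qnorm.
  by rewrite -pmulrn; ring.
have [[A' AE] [B' BE]] : (exists A', A = 2 * A') /\ (exists B', B = 2 * B').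
  have [e De] : exists e : int, D%:Z = 4 * e + 2.
    by exists (D %/ 4)%N%:Z; lia.
  have par (X : int) : exists Y : int, X = 2 * Y \/ X = 2 * Y + 1.
    by exists (X %/ 2)%Z; lia.
  move: E; rewrite {}De.
  have [A' [] ->] := par A; have [B' [] ->] := par B => E.
  - by split; [exists A' | exists B'].
  - by exfalso; lia.
  - by exfalso; lia.
  - by exfalso; lia.
exists A', B'; rewrite /qelt; congr (ratr _ + ratr _ * _).
  by apply: (@mulfI _ (2 : rat)) => //; rewrite aA AE intrM.
by apply: (@mulfI _ (2 : rat)) => //; rewrite bB BE intrM.
Qed.

(** * Diophantine approximation, and an equation of Pell type *)

Lemma dirichlet (n : nat) (s : rat) : (0 < n)%N ->
  exists (m : nat) (y : int),
    (0 < m <= n)%N /\ `|m%:R * s - y%:~R| * n.+1%:R <= 1.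
Proof.
(* Pigeonhole: [r m] tells which of the [n + 1] subintervals of length [1 / (n + 1)] contains the
   fractional part of [m s]. *)
move=> n0; pose N : rat := n.+1%:R.
have N0 : 0 < N by rewrite ltr0Sn.
pose q (m : nat) : int := (Num.floor (N * (m%:R * s)) %/ n.+1)%Z.
pose r (m : nat) : nat := `|Num.floor (N * (m%:R * s)) %% n.+1|%Z%N.
have rn m : (r m < n.+1)%N.
  by rewrite /r -ltz_nat gez0_abs ?modz_ge0 // ltz_pmod.
have qr m : (q m)%:~R * N + (r m)%:R <= N * (m%:R * s)
    < (q m)%:~R * N + (r m)%:R + 1.
  have -> : (q m)%:~R * N + (r m)%:R = (Num.floor (N * (m%:R * s)))%:~R.
    rewrite [in RHS](divz_eq (Num.floor _) n.+1) intrD intrM.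
    by rewrite pmulrn /r gez0_abs ?modz_ge0.
  by have := floor_itv (N * (m%:R * s)); rewrite intrD.
pose f (i : 'I_n.+1) : 'I_n.+1 := Ordinal (rn i).
have [/injectiveP f_inj|/injectivePn[i [j neq_ij eq_f]]] :=
    boolP (injectiveb f).
  (* If every box is occupied, some [i] is in the last one, and [i s] is within [1 / (n + 1)] of
     [q i + 1]. Here [i] is not 0, which lies in box 0. *)
  have /codomP[i fi] := inj_card_onto f_inj (leqnn _) ord_max.
  have ri : r i = n by have := congr1 val fi.
  exists i, (q i + 1); split.
    rewrite (leq_ord i) andbT lt0n; apply: contraTneq n0 => i0.
    by rewrite -ri i0 /r mul0r mulr0 floor0 mod0z.
  have /andP[] := qr i; rewrite ri intrD.
  have -> : n%:R = N - 1 :> rat by rewrite /N -natr1 addrK.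
  rewrite -/N -[X in `|_| * X](gtr0_norm N0) -normrM ler_norml.
  by move=> ? ?; apply/andP; split; lra.
(* Otherwise two indices share a box, and their difference is the multiplier. *)
wlog lt_ij : i j neq_ij eq_f / (i < j)%N.
  move=> H; have [/H|/H|] := ltngtP i j; first exact.
    by apply; rewrite // eq_sym.
  by move=> /val_inj ij; rewrite ij eqxx in neq_ij.
have eq_r : r i = r j by have := congr1 val eq_f.
exists (j - i)%N, (q j - q i); split.
  by rewrite subn_gt0 lt_ij; have := ltn_ord j; lia.
have := qr i; have := qr j; rewrite eq_r => /andP[? ?] /andP[? ?].
rewrite natrB ?(ltnW lt_ij) // intrD rmorphN /=.
rewrite -/N -[X in `|_| * X](gtr0_norm N0) -normrM ler_norml.
by apply/andP; split; lra.
Qed.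

(** Rounding leaves an error [|u| <= 1/2] on the first coordinate and [dirichlet] an error
    [|v| <= 1 / (n + 1)] on the second. Since [n^2 + 1 < (n + 1)^2], the norm [u^2 - D v^2] lies
    above -1 and is at most 1/4. *)
Lemma qnorm_approx (n : nat) (a b : rat) : (0 < n)%N ->
  exists (m : nat) (x y : int), (0 < m <= n)%N /\
    `|qnorm (n ^ 2 + 1) (m%:R * a - x%:~R) (m%:R * b - y%:~R)| < 1.
Proof.
move=> n0; have [m [y [mn]]] := dirichlet b n0.
set v := m%:R * b - _ => vn.
exists m, (Num.floor (m%:R * a + 2^-1)), y; split=> //.
set u := m%:R * a - _.
have u4 : u ^+ 2 <= 4^-1.
  have := floor_itv (m%:R * a + 2^-1); rewrite intrD => /andP[? ?].
  have : `|u| <= 2^-1 by rewrite ler_norml /u; apply/andP; split; lra.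
  rewrite -real_normK ?num_real // => u2.
  have -> : 4^-1 = 2^-1 ^+ 2 :> rat by [].
  by rewrite lerXn2r // nnegrE.
have v1 : (n ^ 2 + 1)%:R * v ^+ 2 < 1.
  have [->|v0] := eqVneq v 0; first by rewrite expr0n mulr0.
  apply: (@lt_le_trans _ _ ((`|v| * n.+1%:R) ^+ 2)); last first.
    by rewrite expr_le1 // mulr_ge0.
  rewrite exprMn real_normK ?num_real // mulrC ltr_pM2l ?exprn_even_gt0 //.
  by rewrite -natrX ltr_nat; lia.
have u0 := sqr_ge0 u.
rewrite /qnorm; move: v1.
have : 0 <= (n ^ 2 + 1)%:R * v ^+ 2 by rewrite mulr_ge0 ?sqr_ge0.
move: (_ * v ^+ 2) => w ? ?.
by rewrite ltr_norml; apply/andP; split; lra.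
Qed.

(* Multiplication by the unit [sqrt D - n], of norm -1, sends the solution
   [(x, y)] to [(D y - n x, x - n y)], whose second coordinate is smaller. *)
Lemma pell_pm2 (n x y : int) : 1 < n -> 0 <= x -> 0 <= y ->
  x ^+ 2 - (n ^+ 2 + 1) * y ^+ 2 <> 2 /\ x ^+ 2 - (n ^+ 2 + 1) * y ^+ 2 <> - 2.
Proof.
move=> n1; have [k] := ubnP `|y|%N.
elim: k x y => // k IH x y yk x0 y0.
suff H : x ^+ 2 - (n ^+ 2 + 1) * y ^+ 2 = 2 \/
    x ^+ 2 - (n ^+ 2 + 1) * y ^+ 2 = - 2 -> False.
  by split=> E; apply: H; [left | right].
move=> E.
have [y1|y1] := ltP 1 y.
  (* These bounds give [0 < x - n y < y]. The absolute value below avoids proving that the new first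
     coordinate is nonnegative; the norm -1 of the unit exchanges the cases 2 and -2. *)
  have xny : n * y < x by nia.
  have xny' : x < (n + 1) * y by nia.
  have [] := IH `|(n ^+ 2 + 1) * y - n * x| (x - n * y).
  - by nia.
  - by [].
  - by nia.
  - rewrite real_normK ?num_real // => H1 H2.
    case: E => E; [apply: H2; rewrite -E | apply: H1; rewrite -[2]opprK -E].
      by ring.
    by ring.
(* Neither 2 nor -2 is a square, and for [n > 1] neither [n^2 + 3] nor [n^2 - 1] is one. *)
have [y00|y11] : y = 0 \/ y = 1 by lia.
  by move: E; rewrite y00; have [x1|x1] := leP x 1; [nia | nia].
move: E; rewrite y11.
by have [xn|xn|->] := ltgtP x n; [nia | nia | lia].
Qed.

Local Open Scope classical_set_scope.

(** * Fractional ideals and small representatives of their classes *)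

Section Ideals.

Variables (D : nat) (sqfD : squarefree D) (D4 : (D %% 4 = 2)%N).

Let K := quadratic_field D.
Let O := ring_of_integers K.

Let nsqD r : r ^+ 2 != D%:R :> rat.
Proof. by apply: squarefree_nonsquare => //; lia. Qed.

Let OE (x : algC) : O x <-> exists a b : int, x = qelt D a%:~R b%:~R.
Proof. exact: ring_of_integersE. Qed.

Lemma quadratic_fieldM x y : K x -> K y -> K (x * y).
Proof.
move=> [a [b ->]] [c [d ->]]; rewrite -!/(qelt D _ _) qeltM.
by do 2!eexists.
Qed.

Lemma quadratic_fieldV x : K x -> K x^-1.
Proof.
by move=> [a [b ->]]; rewrite -/(qelt D _ _) (qeltV nsqD); do 2!eexists.
Qed.

Lemma ring_of_integersD x y : O x -> O y -> O (x + y).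
Proof.
move=> /OE[a [b ->]] /OE[c [d ->]]; apply/OE.
by exists (a + c), (b + d); rewrite qeltD !intrD.
Qed.

Lemma ring_of_integersM x y : O x -> O y -> O (x * y).
Proof.
move=> /OE[a [b ->]] /OE[c [d ->]]; apply/OE.
exists (a * c + D%:Z * b * d), (a * d + b * c).
by rewrite qeltM !intrD !intrM -pmulrn.
Qed.

Lemma ring_of_integers_int (m : int) : O m%:~R.
Proof.
by apply/OE; exists m, 0; rewrite /qelt rmorph0 mul0r addr0 ratr_int.
Qed.

Lemma ring_of_integers_nat (m : nat) : O m%:R.
Proof. by rewrite pmulrn; apply: ring_of_integers_int. Qed.

Lemma fractional_ideal_integers : fractional_ideal K O.
Proof.
split.
- by move=> x [].
- by split; [exact: (ring_of_integers_nat 0) | exact: ring_of_integersD].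
- exact: ring_of_integersM.
- by exists 1; [exact: (ring_of_integers_nat 1) | exact: oner_neq0].
- exists 1; first by split; [exact: (ring_of_integers_nat 1) | exact: oner_neq0].
  by move=> x; rewrite mul1r.
Qed.

Lemma ideal_classZ (I : set algC) x : K x -> x != 0 ->
  ideal_class K [set x * y | y in I] = ideal_class K I.
Proof.
move=> Kx x0; apply/seteqP; split=> J [y [Ky y0] ->].
  exists (y * x); first by split; [exact: quadratic_fieldM | rewrite mulf_neq0].
  by rewrite image_comp; apply: eq_imagel => z _ /=; rewrite mulrA.
exists (y / x).
  split; last by rewrite mulf_neq0 ?invr_eq0.
  by apply: quadratic_fieldM => //; apply: quadratic_fieldV.
by rewrite image_comp; apply: eq_imagel => z _ /=; rewrite mulrA divfK.
Qed.

(* The ideal [I] is multiplied by [n! / y0], where [y0] is an element of [I]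
   of least nonzero norm: if [m y / y0] is within norm 1 of the integer [b],
   then [m y - b y0] vanishes, having smaller norm than [y0]. *)
Lemma ideal_class_repr (n : nat) (I : set algC) :
    (forall a b : rat, exists (m : nat) (x y : int), (0 < m <= n)%N /\
       `|qnorm D (m%:R * a - x%:~R) (m%:R * b - y%:~R)| < 1) ->
  fractional_ideal K I ->
  exists2 x, K x /\ x != 0 & [set x * y | y in I] `<=` O /\ I (n`!%:R / x).
Proof.
move=> approx [IK [I0 ID] IM [z Iz z0] [d [Od d0] dI]].
(* Multiplying by [d] makes the elements of [I] integral, so their norms become natural numbers and
   a least one exists. *)
pose P k := `[< exists y, [/\ I y, y != 0 & exists a b : int,
  d * y = qelt D a%:~R b%:~R /\ (k%:R = `|qnorm D a%:~R b%:~R|)] >].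
have nat_norm (a b : int) :
    exists k : nat, (k%:R = `|qnorm D a%:~R b%:~R| :> rat).
  exists (absz (a ^+ 2 - D%:Z * b ^+ 2)%R).
  by rewrite pmulrn abszE intr_norm intrB /qnorm !expr2 !intrM -pmulrn.
have exP : exists k, P k.
  have /OE[a [b dz]] := dI _ Iz.
  have [k kE] := nat_norm a b.
  by exists k; apply/asboolP; exists z; split=> //; exists a, b.
have [k /asboolP[y0 [Iy0 nz_y0 [a0 [b0 [dy0 kE]]]]] kmin] := ex_minnP exP.
have k_gt0 : 0 < k%:R :> rat.
  rewrite kE normr_gt0; apply: contra_neq (mulf_neq0 d0 nz_y0) => N0.
  by rewrite dy0; have [-> ->] := qnorm_eq0 nsqD N0; rewrite /qelt rmorph0 mul0r addr0.
have Ky0 := quadratic_fieldV (IK _ Iy0).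
have nF : n`!%:R != 0 :> algC by rewrite pnatr_eq0 -lt0n fact_gt0.
exists (n`!%:R / y0).
  split; last by rewrite mulf_neq0 ?invr_eq0.
  by apply: quadratic_fieldM => //; have [] := ring_of_integers_nat n`!.
split; last by rewrite invfM invrK mulrA divff ?mul1r.
move=> _ [y Iy <-].
have [a [b]] := quadratic_fieldM (IK _ Iy) Ky0; rewrite -/(qelt D a b) => yE.
have [m [u [v [mn lt1]]]] := approx a b.
set a' := m%:R * a - _ in lt1; set b' := m%:R * b - _ in lt1.
have gE : qelt D a' b' = m%:R * (y / y0) - qelt D u%:~R v%:~R.
  by rewrite yE /qelt /a' /b' !rmorphB !rmorphM /= ratr_nat; ring.
have Ouv : O (qelt D u%:~R v%:~R) by apply/OE; exists u, v.
pose t := y0 * qelt D a' b'.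
have It : I t.
  have -> : t = m%:R * y + -1%:~R * (qelt D u%:~R v%:~R * y0).
    by rewrite /t gE; field.
  apply: ID; first exact: (IM _ _ (ring_of_integers_nat m) Iy).
  by apply: (IM _ _ (ring_of_integers_int (- 1))); apply: IM.
have g0 : qelt D a' b' = 0.
  apply/eqP/negPn/negP => g0.
  have /OE[c [e dt]] := dI _ It.
  have [l lE] := nat_norm c e.
  have /kmin : P l.
    by apply/asboolP; exists t; split=> //; [exact: mulf_neq0 | exists c, e].
  rewrite leqNgt => /negP[].
  rewrite -(ltr_nat rat) lE; move: dt.
  rewrite /t mulrA dy0 qeltM => /(qelt_inj nsqD)[<- <-].
  by rewrite qnormM normrM -kE gtr_pMr.
(* The multiplier [m] depends on [y], but it always divides [n!]. *)
have [j nE] : exists j, (n`! = j * m)%N by apply/dvdnP/dvdn_fact.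
have -> : n`!%:R / y0 * y = j%:R * qelt D u%:~R v%:~R.
  rewrite nE natrM mulrAC -!mulrA; congr (_ * _).
  by apply/eqP; rewrite -subr_eq0 -gE g0.
exact/ring_of_integersM/Ouv/ring_of_integers_nat.
Qed.

(** * Finiteness of the set of classes *)

Section Cosets.

Variable M : nat.
Hypothesis M_gt0 : (0 < M)%N.

Let residue (a : int) : 'I_M.-1.+1 := inord `|(a %% M)%Z|.

Let coset_union (T : {set 'I_M.-1.+1 * 'I_M.-1.+1}) : set algC :=
  [set z | exists a b : int,
     z = qelt D a%:~R b%:~R /\ (residue a, residue b) \in T].

Let residueE (a : int) : (a = (a %/ M)%Z * M%:Z + residue a)%R.
Proof.
have M0 : M%:Z != 0 by rewrite -lt0n.
rewrite [LHS](divz_eq a M) /residue inordK.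
  by rewrite gez0_abs // modz_ge0.
rewrite prednK // -ltz_nat gez0_abs ?modz_ge0 //.
by rewrite ltz_pmod.
Qed.

(** An ideal containing [M] is a union of cosets of [M O], hence determined by the pairs of residues
    mod [M] of the coordinates of its elements. *)
Lemma finite_ideals_containing :
  finite_set [set J : set algC | [/\ J `<=` O, J M%:R,
    forall x y, J x -> J y -> J (x + y) &
    forall a x, O a -> J x -> J (a * x)]].
Proof.
apply: (@sub_finite_set _ _ (range coset_union)); last first.
  exact/finite_image/finite_finset.
move=> J [JO JM JD JMl].
have step (a b : int) : exists2 z, O z &
    qelt D a%:~R b%:~R =
    qelt D (residue a : int)%:~R (residue b : int)%:~R + z * M%:R.
  exists (qelt D (a %/ M)%Z%:~R (b %/ M)%Z%:~R).
    by apply/OE; do 2!eexists.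
  rewrite {1}(residueE a) {1}(residueE b) /qelt !intrD !intrM !rmorphD !rmorphM /=.
  by rewrite -!pmulrn !ratr_nat; ring.
exists [set p : 'I_M.-1.+1 * 'I_M.-1.+1 |
  `[< J (qelt D (p.1 : int)%:~R (p.2 : int)%:~R) >]]%SET => //.
apply/seteqP; split=> [_ [a [b [-> ]]]|z Jz].
  rewrite inE => /asboolP /= Jab; have [w Ow ->] := step a b.
  by apply: JD => //; apply: JMl.
have /OE[a [b zE]] := JO _ Jz; exists a, b; split=> //.
rewrite inE; apply/asboolP => /=.
have [w Ow wE] := step a b.
have -> : qelt D (residue a : int)%:~R (residue b : int)%:~R = z + - w * M%:R.
  by rewrite zE wE; ring.
apply: JD => //; apply: JMl => //; rewrite -mulN1r.
by apply: ring_of_integersM => //; apply: (ring_of_integers_int (- 1)).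
Qed.

End Cosets.

Lemma ideal_classes_sub (n : nat) :
    (forall a b : rat, exists (m : nat) (x y : int), (0 < m <= n)%N /\
       `|qnorm D (m%:R * a - x%:~R) (m%:R * b - y%:~R)| < 1) ->
  ideal_classes K `<=` [set ideal_class K J | J in
    [set J : set algC | [/\ J `<=` O, J n`!%:R,
      forall x y, J x -> J y -> J (x + y) &
      forall a x, O a -> J x -> J (a * x)]]].
Proof.
move=> approx _ [I fI <-].
have [x [Kx x0] [JO In]] := ideal_class_repr approx fI.
exists [set x * y | y in I]; last exact: ideal_classZ.
have [_ [_ ID] IM _ _] := fI.
split=> //.
- by exists (n`!%:R / x) => //; rewrite mulrC divfK.
- move=> _ _ [y Iy <-] [z Iz <-]; exists (y + z); first exact: ID.
  by rewrite mulrDr.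
- by move=> a _ Oa [y Iy <-]; exists (a * y); [exact: IM | rewrite mulrCA].
Qed.

(** * The prime above 2 *)

Definition ramified_ideal : set algC :=
  [set z | exists a b : int, z = qelt D (2 * a)%:~R b%:~R].

(** As [D] is even, 2 and [sqrt D] already span the ideal [(2, sqrt D)] over the integers. *)
Lemma fractional_ramified_ideal : fractional_ideal K ramified_ideal.
Proof.
have PO z : ramified_ideal z -> O z.
  by move=> [a [b ->]]; apply/OE; do 2!eexists.
split.
- by move=> z /PO[].
- split; first by exists 0, 0; rewrite /qelt mulr0 rmorph0 mul0r addr0.
  move=> _ _ [a [b ->]] [c [d ->]]; exists (a + c), (b + d).
  by rewrite qeltD mulrDr !intrD.
- move=> _ _ /OE[a [b ->]] [c [d ->]].
  exists (a * c + (D %/ 2)%N%:Z * b * d), (a * d + 2 * b * c).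
  have -> : (2 * (a * c + (D %/ 2)%N%:Z * b * d) = a * (2 * c) + D%:Z * b * d)%R.
    have -> : D%:Z = 2 * (D %/ 2)%N%:Z by lia.
    by ring.
  rewrite qeltM !intrD !intrM -pmulrn; congr (qelt _ _ (_ + _)); ring.
- exists 2%:R; last by rewrite pnatr_eq0.
  by exists 1, 0; rewrite /qelt rmorph0 mul0r addr0 ratr_int.
- exists 1; first by split; [exact: (ring_of_integers_nat 1) | exact: oner_neq0].
  by move=> x; rewrite mul1r; apply: PO.
Qed.

(* A generator has even norm dividing both [4] and [D = 2 mod 4]. *)
Lemma ramified_ideal_generator (x : algC) :
  ramified_ideal = [set x * y | y in O] ->
  exists a b : int, a ^+ 2 - D%:Z * b ^+ 2 = 2 \/ a ^+ 2 - D%:Z * b ^+ 2 = - 2.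
Proof.
move=> PxO.
have qeltP (a b c d e f : int) :
    qelt D a%:~R b%:~R = qelt D c%:~R d%:~R * qelt D e%:~R f%:~R ->
  a ^+ 2 - D%:Z * b ^+ 2 = (c ^+ 2 - D%:Z * d ^+ 2) * (e ^+ 2 - D%:Z * f ^+ 2).
  have normE (u v : int) :
      (u ^+ 2 - D%:Z * v ^+ 2)%:~R = qnorm D u%:~R v%:~R.
    by rewrite /qnorm intrB !expr2 !intrM -pmulrn.
  rewrite qeltM => /(qelt_inj nsqD)[aE bE].
  by apply: (@intr_inj rat); rewrite intrM !normE aE bE qnormM.
have O1 : O 1 := ring_of_integers_nat 1.
have : ramified_ideal x by rewrite PxO; exists 1 => //; rewrite mulr1.
move=> [a [b xE]]; exists (2 * a), b.
have : ramified_ideal 2.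
  by exists 1, 0; rewrite /qelt rmorph0 mul0r addr0 ratr_int.
rewrite {1}PxO xE => -[_ /OE[c [d ->]] E2].
have : ramified_ideal (qelt D 0%:~R 1%:~R) by exists 0, 1; rewrite mulr0.
rewrite {1}PxO xE => -[_ /OE[e [f ->]] Es].
have {}E2 : 2 ^+ 2 - D%:Z * 0 ^+ 2 =
    ((2 * a) ^+ 2 - D%:Z * b ^+ 2) * (c ^+ 2 - D%:Z * d ^+ 2).
  by apply: qeltP; rewrite E2 /qelt rmorph0 mul0r addr0 ratr_int.
have {}Es := qeltP _ _ _ _ _ _ (esym Es).
have [h Dh] : exists h : int, D%:Z = 2 * (2 * h + 1).
  by exists (D %/ 4)%N%:Z; lia.
move: E2 Es; rewrite {}Dh.
have -> : (2 * a) ^+ 2 - 2 * (2 * h + 1) * b ^+ 2 =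
    2 * (2 * a ^+ 2 - (2 * h + 1) * b ^+ 2) by ring.
move: (_ - (2 * h + 1) * b ^+ 2) => k.
move: (c ^+ 2 - _) (e ^+ 2 - _) => w v E2 Es.
(* The generator has norm [2 k]. Since it divides 2, of norm 4, and [sqrt D], of norm [-D], the
   integer [k] divides both 2 and the odd number [D / 2]. *)
have {}E2 : k * w = 2 by lia.
have {}Es : k * v = - (2 * h + 1) by lia.
have k2 : (`|k| <= 2)%N.
  by apply: dvdn_leq => //; apply/dvdnP; exists `|w|%N; rewrite mulnC -abszM E2.
have [->|[->|[k0|[k1|k1]]]] : k = 1 \/ k = -1 \/ k = 0 \/ k = 2 \/ k = -2 by lia.
- by left.
- by right.
- by move: E2; rewrite k0 mul0r.
- by move: Es; rewrite k1; lia.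
- by move: Es; rewrite k1; lia.
Qed.

End Ideals.

(* The class number *)
Local Close Scope classical_set_scope.
Local Close Scope ring_scope.

Theorem corollary1p7 (n : nat) (odd_n : odd n)
    (sqf : squarefree (n ^ 2 + 1)) :
  1 < class_number (n ^ 2 + 1) <-> 1 < n.
Proof.
have n0 : 0 < n by case: n odd_n sqf.
have D4 : (n ^ 2 + 1) %% 4 = 2.
  have [k ->] : exists k, n = k.*2.+1 by exists n./2; rewrite -[LHS]odd_double_half odd_n.
  lia.
have approx a b := qnorm_approx a b n0.
have sub := ideal_classes_sub sqf D4 approx.
(* Finiteness is what makes membership in [fset_set] meaningful: on an infinite set it is empty. *)
have fin : finite_set (ideal_classes (quadratic_field (n ^ 2 + 1))).
  apply: sub_finite_set sub _; apply/finite_image.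
  exact: finite_ideals_containing (fact_gt0 n).
set K := quadratic_field _ in fin *.
have fO := fractional_ideal_integers sqf D4.
rewrite /class_number -/K; split=> [|n1].
  apply: contraTT; rewrite -!leqNgt => n1.
  (* Now [n! = 1], so each representative [J] contains 1 and equals the ring of integers. *)
  have {n1}nE : n = 1 by apply/eqP; rewrite eqn_leq n1.
  rewrite -(cardfs1 (ideal_class K (ring_of_integers K))).
  apply/fsubset_leq_card/fsubsetP => c; rewrite in_fset_set // inE in_fset1.
  move=> /sub[J [JO J1 _ JM] <-]; apply/eqP; congr ideal_class.
  apply/seteqP; split=> // z Oz; rewrite -[z]mulr1; apply: JM => //.
  by move: J1; rewrite {1}nE.
pose c1 := ideal_class K (ring_of_integers K).
pose c2 := ideal_class K (ramified_ideal (n ^ 2 + 1)).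
have c12 : c1 != c2.
  apply/eqP => c12.
  have : c2 (ramified_ideal (n ^ 2 + 1)).
    exists 1%R; last by under eq_imagel do rewrite mul1r; rewrite image_id.
    split; last exact: oner_neq0.
    by have [K1 _] := ring_of_integers_nat sqf D4 1; exact: K1.
  (* If the classes agreed, the ramified ideal would be [x O], hence principal; absolute values turn
     the resulting solution into a nonnegative one. *)
  rewrite -c12 => -[x _ /(ramified_ideal_generator sqf D4)[a [b E]]].
  have [] := @pell_pm2 n%:Z `|a|%R `|b|%R; [by [] | exact: normr_ge0 | exact: normr_ge0 |].
  rewrite !real_normK ?num_real //.
  have -> : (n%:Z ^+ 2 + 1 = (n ^ 2 + 1)%:Z)%R by rewrite -mulnn PoszD PoszM expr2.
  by case: E.
have -> : 2 = #|` [fset c1; c2]|%fset by rewrite cardfs2 c12.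
apply/fsubset_leq_card/fsubsetP => c; rewrite in_fset2 in_fset_set //.
rewrite inE => /orP[] /eqP ->.
  by exists (ring_of_integers K).
by exists (ramified_ideal (n ^ 2 + 1)) => //; exact: fractional_ramified_ideal.
Qed.
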